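(* For every natural number $s\in\mathbb{N}$ there exists $m=m(s)\in\mathbb{N}$ such that for every finite set $A$ of real numbers, \[ |(sA-sA)^{(m)}| \gg_s |A|^{s}. \]
   Context: For $X\subseteq\mathbb{R}$, $sX-sX=\{x_1+\dots+x_s-y_1-\dots-y_s:x_i,y_j\in X\}$, and $X^{(m)}$ denotes the $m$-fold product set $\{x_1x_2\cdots x_m: x_i\in X\}$. The notation $X\gg_s Y$ means $X\ge c(s)Y$ for a constant $c(s)>0$ depending only on $s$. *)

(* Defs.v *)
From mathcomp Require Import all_boot all_order all_algebra finmap.
From mathcomp Require Import reals.

Set Implicit Arguments.
Unset Strict Implicit.
Unset Printing Implicit Defensive.

Import Order.TTheory GRing.Theory Num.Theory.
Local Open Scope fset_scope.
Local Open Scope ring_scope.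

(* An s-tuple of elements of X is a map from 'I_s to the finite type of elements
   of X; elements may be repeated.  For s = 0 the result is {0}, even when X
   is empty. *)
Definition sum_diff_set (R : realType) (s : nat) (X : {fset R}) : {fset R} :=
  [fset \sum_(i < s) val (x i) - \sum_(j < s) val (y j) |
     x : {ffun 'I_s -> X} in predT, y : {ffun 'I_s -> X} in predT].

Definition prod_set (R : realType) (m : nat) (X : {fset R}) : {fset R} :=
  [fset \prod_(i < m) val (x i) | x : {ffun 'I_m -> X} in predT].

(* Main.v *)
(** Put s = r + 1, P = sA - sA and K = 2r + 1, and let h be the least positive
    difference of elements of A. The points y_i = a_(i+s) - a_0 - r h are
    positive and h-separated, and y_i + j h lies in P for 0 <= j <= 2r. With
    g_l = (-Delta_h)^l ln, which is strictly increasing for every l, the sums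
      g_0(x_0) - g_1(x_1) + g_2(x_2) - ... + g_(K-1)(x_(K-1)),
      x_0 < x_1 < ... in {y_i},
    are pairwise distinct, because the tail moves g_0(x_0) by less than
    g_0(x_0 + h) - g_0(x_0), hence not beyond the next point. Each sum is
    ln U - ln V with U, V products of elements of P, so there are >> |A|^(2s-1)
    distinct ratios U / V. Multiplying U and V by a common y_i gives
    >> |A|^(2s) distinct pairs of products, whence |P^(m)|^2 >> |A|^(2s). *)

Require Import Defs.
From mathcomp Require Import all_boot all_order all_algebra finmap.
From mathcomp Require Import reals.
From mathcomp Require Import topology normedtype derive realfun exp.
From mathcomp Require Import zify ring lra.

Set Implicit Arguments.
Unset Strict Implicit.
Unset Printing Implicit Defensive.

Import Order.TTheory GRing.Theory Num.Theory.
Import numFieldNormedType.Exports.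
Local Open Scope fset_scope.
Local Open Scope ring_scope.

(** * Iterated differences of the logarithm *)

Definition bwd_diff (R : realType) (h : R) (f : R -> R) : R -> R :=
  fun x => f x - f (x + h).

(** The products for [x] and [x + h] agree except for the end factors [x] and [x + (l+1) h]; the
    difference of these, [(l+1) h], is what turns [l! h^l] into the next numerator. The formula
    makes the sign visible. *)
Lemma iter_bwd_diff_inv (R : realType) (h : R) (l : nat) (x : R) :
  0 < h -> 0 < x ->
  iter l (bwd_diff h) (@GRing.inv R) x =
    l`!%:R * h ^+ l / \prod_(j < l.+1) (x + j%:R * h).
Proof.
move=> h0; elim: l x => [|l IHl] x x0 /=.
  by rewrite big_ord1 mul0r addr0 expr0 fact0 !mul1r.
have pos y (j : nat) : 0 < y -> y + j%:R * h != 0.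
  by move=> y0; rewrite gt_eqF// ltr_pwDl// mulr_ge0// ltW.
rewrite /bwd_diff !IHl ?addr_gt0//.
have recl : \prod_(j < l.+2) (x + j%:R * h) =
    x * \prod_(j < l.+1) (x + h + j%:R * h).
  rewrite big_ord_recl mul0r addr0; congr (_ * _).
  by apply: eq_bigr => j _; rewrite /= /bump /= natrD; ring.
have E : x * \prod_(j < l.+1) (x + h + j%:R * h) =
    \prod_(j < l.+1) (x + j%:R * h) * (x + l.+1%:R * h).
  by rewrite -recl big_ord_recr.
rewrite recl; set p := \prod_(j < l.+1) (x + j%:R * h) in E *.
set q := \prod_(j < l.+1) (x + h + j%:R * h) in E *.
have p0 : p != 0 by apply/prodf_neq0 => j _; exact: pos.
have q0 : q != 0 by apply/prodf_neq0 => j _; apply: pos; rewrite addr_gt0.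
have xn0 : x != 0 by rewrite gt_eqF.
have -> : p^-1 = (x + l.+1%:R * h) / (x * q).
  by rewrite E invfM mulrCA mulfV ?mulr1// pos.
rewrite factS natrM exprS; field; by rewrite xn0 q0.
Qed.

Lemma is_derive_iter_bwd_diff (R : realType) (h : R) (f f' : R -> R) :
    0 < h -> (forall x : R, 0 < x -> is_derive x (1 : R) f (f' x)) ->
  forall l (x : R), 0 < x ->
    is_derive x (1 : R) (iter l (bwd_diff h) f) (iter l (bwd_diff h) f' x).
Proof.
move=> h0 ff'; elim=> [|l IHl] x x0 /=; first exact: ff'.
rewrite /bwd_diff; apply: is_deriveB; first exact: IHl.
have xh0 : 0 < x + h by rewrite addr_gt0.
have -> : iter l (bwd_diff h) f' (x + h) = iter l (bwd_diff h) f' (x + h) * 1.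
  by rewrite mulr1.
have Ds : is_derive x 1 (fun y => y + h) (1 : R) by exact: is_derive_shift.
exact: (@is_derive1_comp _ (iter l (bwd_diff h) f) (fun y => y + h) x _ 1
          (IHl _ xh0) Ds).
Qed.

(* The l-th iterate of [bwd_diff h] is (-1)^l times the l-th forward
   difference. *)
Definition alternating (R : realType) (h : R) (f : R -> R) :=
  forall l x y, 0 < x -> x < y ->
    iter l (bwd_diff h) f x < iter l (bwd_diff h) f y.

Lemma alternating_bwd_diff (R : realType) (h : R) (f : R -> R) :
  alternating h f -> alternating h (bwd_diff h f).
Proof. by move=> fA l x y x0 xy; rewrite -!iterSr; exact: fA. Qed.

(** Differencing commutes with differentiation, so the [l]-th iterate has derivative
    [l! h^l / (x (x+h) ... (x+lh))], which is positive. *)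
Lemma alternating_ln (R : realType) (h c : R) :
  0 < h -> alternating h (fun x => ln x - c).
Proof.
move=> h0 l x y x0 xy.
have Df (z : R) : 0 < z -> is_derive z (1 : R) (fun x => ln x - c) (z^-1).
  move=> z0; rewrite -[z^-1]subr0; apply: is_deriveB; exact: is_derive1_ln.
have D := is_derive_iter_bwd_diff h0 Df l.
have z0 z : z \in `[x, y] -> 0 < z.
  by rewrite in_itv => /andP[xz _]; exact: lt_le_trans x0 xz.
have z0' z : z \in `]x, y[ -> 0 < z.
  by move=> /subset_itv_oo_cc; exact: z0.
apply: (@gtr0_derive1_lt_cc _ _ x y); rewrite ?bound_itvE ?ltW//.
- by move=> z /z0' /D [].
- move=> z /z0' zp; rewrite derive1E; have [_ ->] := D z zp.
  rewrite iter_bwd_diff_inv// divr_gt0 ?mulr_gt0 ?exprn_gt0 ?ltr0n ?fact_gt0//.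
  by apply: prodr_gt0 => j _; rewrite ltr_pwDl// mulr_ge0// ltW.
- apply: derivable_within_continuous => z /z0 /D [] //.
Qed.

(** * Alternating sums along increasing sequences *)

Fixpoint nested (R : realType) (h : R) (f : R -> R) (s : seq R) : R :=
  if s is x :: s' then f x - nested h (bwd_diff h f) s' else 0.

(** With [g = bwd_diff h f], induction puts the tail in [[g y, g (y + h))]. The upper end is
    negative since [f] increases, and the lower end exceeds [g x = f x - f (x + h)] since [g]
    increases. *)
Lemma nested_bounds (R : realType) (h : R) (f : R -> R) (x : R) (s : seq R) :
    0 < h -> alternating h f -> 0 < x -> path <%R x s ->
  f x <= nested h f (x :: s) < f (x + h).
Proof.
move=> h0; elim: s f x => [|y s IHs] f x fA x0 /=.
  by move=> _; rewrite subr0 lexx (fA 0)//= ltrDl.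
move=> /andP[xy ys]; have y0 := lt_trans x0 xy.
have gA := alternating_bwd_diff fA.
have /andP[/= lo hi] := IHs (bwd_diff h f) y gA y0 ys.
have neg : bwd_diff h f (y + h) < 0.
  by rewrite subr_lt0 (fA 0)//= ?ltrDl// addr_gt0.
have := gA 0 x y x0 xy; rewrite /= {1}/bwd_diff => xy'.
by apply/andP; split; lra.
Qed.

(** For [h]-separated points the intervals [[f x, f (x + h))] are disjoint, so the value determines
    the head; cancelling [f x] leaves the same problem for [bwd_diff h f]. *)
Lemma nested_inj (R : realType) (h : R) (f : R -> R) (s t : seq R) :
    0 < h -> alternating h f ->
    (forall a b, a \in s ++ t -> b \in s ++ t -> a < b -> a + h <= b) ->
    (forall a, a \in s ++ t -> 0 < a) ->
    sorted <%R s -> sorted <%R t -> size s = size t ->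
  nested h f s = nested h f t -> s = t.
Proof.
move=> h0; elim: s f t => [|x s IHs] f [|y t]//= fA sep pos xs yt [st] E.
have xin : x \in (x :: s) ++ y :: t by rewrite mem_head.
have yin : y \in (x :: s) ++ y :: t by rewrite mem_cat mem_head orbT.
have [x0 y0] : 0 < x /\ 0 < y by split; apply: pos.
have /andP[xlo xhi] := nested_bounds h0 fA x0 xs.
have /andP[ylo yhi] := nested_bounds h0 fA y0 yt.
have fle a b : 0 < a -> a <= b -> f a <= f b.
  by move=> a0; rewrite le_eqVlt => /orP[/eqP->//|ab]; exact/ltW/(fA 0).
have xy : x = y.
  have [xy|xy|//] := ltgtP x y.
  - have := fle _ _ (addr_gt0 x0 h0) (sep _ _ xin yin xy).
    by move: xhi ylo => /=; rewrite E => ? ? ?; lra.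
  - have := fle _ _ (addr_gt0 y0 h0) (sep _ _ yin xin xy).
    by move: yhi xlo => /=; rewrite E => ? ? ?; lra.
rewrite -xy in E *; congr (_ :: _).
have sub a : a \in s ++ t -> a \in (x :: s) ++ y :: t.
  by rewrite !mem_cat !inE => /orP[]->; rewrite ?orbT.
apply: (IHs (bwd_diff h f)) => //; first exact: alternating_bwd_diff.
- by move=> a b /sub ain /sub bin; exact: sep.
- by move=> a /sub; exact: pos.
- exact: path_sorted xs.
- exact: path_sorted yt.
- by move: E => /addrI /oppr_inj.
Qed.

(** * Membership in product sets and in sA - sA *)

Lemma prod_set1 (R : realType) (X : {fset R}) : 1 \in prod_set 0 X.
Proof.
have z : {ffun 'I_0 -> X} by apply: finfun => -[].
by apply/imfsetP; exists z => //; rewrite big_ord0.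
Qed.

Lemma ffun_ord_cons (T : Type) (n : nat) (a : T) (x : {ffun 'I_n -> T}) :
  exists2 y : {ffun 'I_n.+1 -> T},
    y ord0 = a & forall i, y (lift ord0 i) = x i.
Proof.
exists [ffun i => oapp x a (unlift ord0 i)]; first by rewrite ffunE unlift_none.
by move=> i; rewrite ffunE liftK.
Qed.

Lemma prod_setS (R : realType) (m : nat) (X : {fset R}) (p u : R) :
  p \in X -> u \in prod_set m X -> p * u \in prod_set m.+1 X.
Proof.
move=> pX /imfsetP[/= x _ ->]; have [y y0 yS] := ffun_ord_cons [` pX] x.
apply/imfsetP; exists y => //=; rewrite big_ord_recl y0.
by under [in RHS]eq_bigr do rewrite yS.
Qed.

Lemma prod_setM (R : realType) (m n : nat) (X : {fset R}) (u v : R) :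
  u \in prod_set m X -> v \in prod_set n X -> u * v \in prod_set (m + n) X.
Proof.
elim: m u => [|m IHm] u /imfsetP[/= x _ ->] vn.
  by rewrite big_ord0 mul1r.
rewrite big_ord_recl -mulrA addSn; apply: prod_setS; first exact: valP.
apply: IHm => //; apply/imfsetP; exists [ffun i => x (lift ord0 i)] => //=.
by apply: eq_bigr => i _; rewrite ffunE.
Qed.

Lemma sum_diff_set0 (R : realType) (X : {fset R}) : 0 \in sum_diff_set 0 X.
Proof.
have z : {ffun 'I_0 -> X} by apply: finfun => -[].
by apply/imfset2P; exists z => //; exists z => //; rewrite !big_ord0 subr0.
Qed.

Lemma sum_diff_setS (R : realType) (s : nat) (X : {fset R}) (a b v : R) :
    a \in X -> b \in X -> v \in sum_diff_set s X ->
  v + (a - b) \in sum_diff_set s.+1 X.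
Proof.
move=> aX bX /imfset2P[/= x _ [y _ ->]].
have [x' x'0 x'S] := ffun_ord_cons [` aX] x.
have [y' y'0 y'S] := ffun_ord_cons [` bX] y.
apply/imfset2P; exists x' => //; exists y' => //.
rewrite !big_ord_recl x'0 y'0 /=.
under [in RHS]eq_bigr do rewrite x'S.
under [in X in _ = _ - (_ + X)]eq_bigr do rewrite y'S.
by ring.
Qed.

(* The shifts run over -r, ..., r times b - b', twice what the forward
   direction alone would give. *)
Lemma sum_diff_set_shift (R : realType) (X : {fset R}) (a a' b b' : R)
    (r j : nat) :
    a \in X -> a' \in X -> b \in X -> b' \in X -> (j <= r.*2)%N ->
  a - a' - r%:R * (b - b') + j%:R * (b - b') \in sum_diff_set r.+1 X.
Proof.
move=> aX a'X bX b'X.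
have eqin (S : {fset R}) (u v : R) : v \in S -> u = v -> u \in S by move=> ? ->.
elim: r j => [|r IHr] j.
  rewrite double0 leqn0 => /eqP->; rewrite mul0r subr0 addr0 -[_ - _]add0r.
  by apply: sum_diff_setS => //; exact: sum_diff_set0.
(* Passing from [r] to [r + 1] moves the starting point by [-(b - b')], so the extra difference is
   [b' - b] for index 0, zero for index 1, and [b - b'] (on top of shift [j]) for index [j + 2]. *)
case: j => [_|[_|j jr]].
- apply: (eqin _ _ _ (sum_diff_setS b'X bX (IHr 0 isT))).
  by rewrite -(natr1 r); ring.
- apply: (eqin _ _ _ (sum_diff_setS bX bX (IHr 0 isT))).
  by rewrite -(natr1 r); ring.
- have jr' : (j <= r.*2)%N by move: jr; rewrite doubleS.
  apply: (eqin _ _ _ (sum_diff_setS bX b'X (IHr j jr'))).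
  by rewrite -(natr1 r) -(natr1 j.+1) -(natr1 j); ring.
Qed.

(** * Logarithms of ratios of products *)

Definition log_ratio (R : realType) (P : {fset R}) (m : nat) (v : R) :=
  exists U V : R, [/\ U \in prod_set m P, V \in prod_set m P, 0 < U, 0 < V &
                      v = ln U - ln V].

Lemma log_ratioB (R : realType) (P : {fset R}) (m n : nat) (v w : R) :
  log_ratio P m v -> log_ratio P n w -> log_ratio P (m + n) (v - w).
Proof.
move=> [U [V [UP VP U0 V0 ->]]] [U' [V' [U'P V'P U'0 V'0 ->]]].
exists (U * V'), (V * U'); split; rewrite ?mulr_gt0 ?prod_setM//.
by rewrite !lnM ?posrE//; ring.
Qed.

(** Each differencing doubles the number of factors and uses one more shift: the counts
    [c, 2c, 4c, ...] add up to [c (2^k - 1)], while [d] grows as [size s] shrinks, so the range of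
    [j] needed from the points stays fixed. *)
Lemma log_ratio_nested (R : realType) (P : {fset R}) (h : R) (f : R -> R)
    (c d : nat) (s : seq R) :
    (forall x,
        (forall j, (j <= d)%N -> x + j%:R * h \in P /\ 0 < x + j%:R * h) ->
      log_ratio P c (f x)) ->
    (forall x, x \in s -> forall j, (j < d + size s)%N ->
      x + j%:R * h \in P /\ 0 < x + j%:R * h) ->
  log_ratio P (c * (2 ^ size s).-1) (nested h f s).
Proof.
elim: s f c d => [|x s IHs] f c d fP sP.
  rewrite muln0; exists 1, 1; split; rewrite ?prod_set1 ?ltr01//.
  by rewrite subrr.
have -> : (c * (2 ^ size (x :: s)).-1 = c + c.*2 * (2 ^ size s).-1)%N.
  by rewrite /= expnS; have := expn_gt0 2 (size s); nia.
apply: log_ratioB.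
  apply: fP => j jd; apply: sP; first exact: mem_head.
  by rewrite /= addnS ltnS (leq_trans jd)// leq_addr.
apply: (IHs _ _ d.+1) => [y yP|y ys j jd].
  rewrite -addnn; apply: log_ratioB; apply: fP => j jd.
    exact: yP (leqW jd).
  have := yP j.+1 jd; rewrite -natr1 mulrDl mul1r.
  by have -> : y + h + j%:R * h = y + (j%:R * h + h) by ring.
apply: sP; first by rewrite inE ys orbT.
by rewrite /= addnS -addSn.
Qed.

Lemma prod_set_gt0 (R : realType) (m : nat) (X : {fset R}) :
  (0 < #|` X|)%N -> (0 < #|` prod_set m X|)%N.
Proof.
rewrite !cardfs_gt0 => /fset0Pn[p pX]; apply/fset0Pn.
elim: m => [|m [u um]]; first by exists 1; exact: prod_set1.
by exists (p * u); exact: prod_setS.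
Qed.

(** * Counting pairs of products *)

Lemma card_prod_set_separated (R : realType) (P : {fset R}) (h : R) (K n : nat)
    (y : nat -> R) :
    0 < h -> (0 < K)%N ->
    (forall i, (i.+1 < K * n)%N -> y i + h <= y i.+1) ->
    (forall i j, (i < K * n)%N -> (j < K)%N ->
      y i + j%:R * h \in P /\ 0 < y i + j%:R * h) ->
  (n ^ K.+1 <= #|` prod_set (2 ^ K) P| ^ 2)%N.
Proof.
move=> h0 K0 yS yP; have [->|n0] := posnP n; first by rewrite exp0n.
have Kn0 : (0 < K * n)%N by rewrite muln_gt0 K0.
have ysep i j : (i < j)%N -> (j < K * n)%N -> y i + h <= y j.
  elim: j => // j IHj; rewrite ltnS leq_eqVlt => /predU1P[->|ij] jn.
    exact: yS.
  apply: le_trans (yS j jn); apply: ler_wpDr (ltW h0) _.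
  exact: IHj ij (ltnW jn).
have ylt i j : (i < j)%N -> (j < K * n)%N -> y i < y j.
  by move=> ij jn; apply: lt_le_trans (ysep _ _ ij jn); rewrite ltrDl.
have yinj i j : (i < K * n)%N -> (j < K * n)%N -> y i = y j -> i = j.
  move=> ik jk yij; have [ij|ij|//] := ltngtP i j.
    by have := ylt _ _ ij jk; rewrite yij ltxx.
  by have := ylt _ _ ij ik; rewrite yij ltxx.
have yP0 i : (i < K * n)%N -> y i \in P /\ 0 < y i.
  by move=> /yP/(_ K0); rewrite mul0r addr0.
have [p0P p0] := yP0 0 Kn0.
(* The l-th point is taken from the l-th of K blocks of n indices, which makes
   the K points increasing for free. *)
pose idx (t : {ffun 'I_K -> 'I_n}) (l : 'I_K) := (l * n + t l)%N.
have idxK t l : (idx t l < K * n)%N.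
  by rewrite /idx; have := ltn_ord l; have := ltn_ord (t l); nia.
pose pts t := [seq y (idx t l) | l <- enum 'I_K].
(* Subtracting ln (y 0) makes f x itself the log of a ratio of elements of P. *)
pose f := fun x : R => ln x - ln (y 0).
have fA : alternating h f by exact: alternating_ln.
have pts_range t x : x \in pts t -> exists2 i, (i < K * n)%N & x = y i.
  by move=> /mapP[l _ ->]; exists (idx t l).
have pts_sorted t : sorted <%R (pts t).
  rewrite sorted_map; have := iota_ltn_sorted 0 K.
  rewrite -val_enum_ord sorted_map; apply: sub_sorted => l l' /= ll'.
  apply: ylt => //; rewrite /idx; have := ltn_ord (t l); nia.
have size_pts t : size (pts t) = K by rewrite size_map size_enum_ord.
have nested_pts_inj : injective (nested h f \o pts).
  move=> t t' /= E; suff : pts t = pts t'.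
    move=> /eq_in_map ptsE; apply/ffunP => l; apply: val_inj => /=.
    have /yinj := ptsE l (mem_enum _ l).
    by move=> /(_ (idxK _ _) (idxK _ _)) /addnI.
  have catP x : x \in pts t ++ pts t' -> exists2 i, (i < K * n)%N & x = y i.
    by rewrite mem_cat => /orP[] /pts_range.
  apply: (nested_inj h0 fA) => //; last by rewrite !size_pts.
  - move=> a b /catP[i ik ->] /catP[j jk ->] yij; apply: ysep => //.
    have [//|ji|ij] := ltngtP i j; last by rewrite ij ltxx in yij.
    by have := lt_trans yij (ylt _ _ ji ik); rewrite ltxx.
  - by move=> a /catP[i /yP0[_ yi0] ->].
have ratioP t : exists UV : R * R,
    [/\ UV.1 \in prod_set (2 ^ K).-1 P, UV.2 \in prod_set (2 ^ K).-1 P,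
        0 < UV.1, 0 < UV.2 & nested h f (pts t) = ln UV.1 - ln UV.2].
  suff [U [V UV]] :
      log_ratio P (1 * (2 ^ size (pts t)).-1) (nested h f (pts t)).
    by exists (U, V); rewrite -(size_pts t) -[_.-1]mul1n.
  apply: (@log_ratio_nested _ _ _ _ _ 0) => [x|x /pts_range[i ik ->] j].
    move=> /(_ 0 isT); rewrite mul0r addr0 => -[xP x0].
    exists (x * 1), (y 0 * 1); rewrite !mulr1; split=> //.
    - by rewrite -[x]mulr1 prod_setS// prod_set1.
    - by rewrite -[y 0]mulr1 prod_setS// prod_set1.
  by rewrite add0n size_pts; exact: yP.
have [UV UVP] := fin_all_exists ratioP.
set Q := prod_set _ P.
have zK (z : 'I_n) : (z < K * n)%N.
  by rewrite (leq_trans (ltn_ord z))// leq_pmull.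
have QS p u : p \in P -> u \in prod_set (2 ^ K).-1 P -> p * u \in Q.
  move=> pP uP; rewrite /Q -[X in prod_set X](prednK (expn_gt0 2 K)).
  exact: prod_setS.
have QU (t : {ffun 'I_K -> 'I_n}) (z : 'I_n) : y z * (UV t).1 \in Q.
  by have [UP _ _ _ _] := UVP t; apply: QS; first exact: (yP0 _ (zK z)).1.
have QV (t : {ffun 'I_K -> 'I_n}) (z : 'I_n) : y z * (UV t).2 \in Q.
  by have [_ VP _ _ _] := UVP t; apply: QS; first exact: (yP0 _ (zK z)).1.
(* The ratio of the two entries forgets the common factor [y z] and recovers [t]; cancelling
   [(UV t).1] then recovers [z]. The factor [y z] also brings the length from [2^K - 1] to [2^K]. *)
pose g (tz : {ffun 'I_K -> 'I_n} * 'I_n) : Q * Q :=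
  ([` QU tz.1 tz.2], [` QV tz.1 tz.2]).
have ginj : injective g.
  move=> [t z] [t' z'] /pair_equal_spec[/(congr1 val)/= E1 /(congr1 val)/= E2].
  have [[_ _ U0 V0 Et] [_ _ U'0 V'0 Et']] := (UVP t, UVP t').
  have [[_ z0] [_ z'0]] := (yP0 _ (zK z), yP0 _ (zK z')).
  have tt' : t = t'.
    apply: nested_pts_inj => /=; rewrite Et Et'.
    have := congr1 (@ln R) E1; have := congr1 (@ln R) E2.
    by rewrite !lnM ?posrE// => ? ?; lra.
  rewrite -tt' in E1 *; congr (_, _); apply: val_inj => /=.
  by apply: yinj => //; apply: (mulIf _ E1); rewrite gt_eqF.
have -> : (n ^ K.+1 = #|{: {ffun 'I_K -> 'I_n} * 'I_n}|)%N.
  by rewrite card_prod card_ffun !card_ord expnSr.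
by rewrite cardfE -mulnn -card_prod; exact: leq_card ginj.
Qed.

(** * The least gap and the final choice of parameters *)

Lemma exists_min_gap (R : realType) (A : {fset R}) :
    (1 < #|` A|)%N ->
  exists b b' : R, [/\ b \in A, b' \in A, b' < b &
    forall c c', c \in A -> c' \in A -> c' < c -> c' + (b - b') <= c].
Proof.
move=> A1; pose gap (x : A * A) : R := val x.1 - val x.2.
have [x x0] : exists x : A * A, 0 < gap x.
  have /card_gt1P[u [v [_ _ uv]]] : (1 < #|{: A}|)%N by rewrite -cardfE.
  have : val u != val v by [].
  rewrite neq_lt => /orP[uv'|uv']; [exists (v, u)|exists (u, v)];
    by rewrite /gap subr_gt0.
case: (arg_minP gap (P := fun x => 0 < gap x) x0) => -[b b'] b0 bmin.
exists (val b), (val b'); split; rewrite ?fsvalP//.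
  by rewrite -subr_gt0.
move=> c c' cA c'A cc'; have := bmin ([` cA], [` c'A]).
by rewrite /gap /= subr_gt0 => /(_ cc'); rewrite lerBrDl.
Qed.

Theorem theorem1p4 (R : realType) (s : nat) :
  exists2 m : nat, (0 < m)%N &
    exists2 c : R, 0 < c &
      forall A : {fset R},
        c * #|` A|%:R ^+ s <= #|` prod_set m (sum_diff_set s A)|%:R.
Proof.
case: s => [|r].
  (* For [s = 0] the bound is 1, and it holds even for empty [A] because 0 lies in the
     sum-difference set. *)
  exists 1%N => //; exists 1 => // A; rewrite expr0 mulr1 ler1n prod_set_gt0//.
  by rewrite cardfs_gt0; apply/fset0Pn; exists 0; exact: sum_diff_set0.
(* [K] counts the available shifts 0, ..., 2r, and [K + 1 = 2 (r + 1)] makes the square root of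
   [n^(K+1)] equal to [n^(r+1)]. *)
pose K := r.*2.+1; exists (2 ^ K)%N; first by rewrite expn_gt0.
exists ((6 * r.+1)%:R ^- r.+1) => [|A].
  by rewrite invr_gt0 exprn_gt0// ltr0n.
rewrite mulrC -expr_div_n; set N := #|` A|; set P := sum_diff_set _ _.
have N0 : 0 <= N%:R / (6 * r.+1)%:R :> R by rewrite divr_ge0.
have [A0|A0] := posnP N; first by rewrite A0 mul0r expr0n.
have /fset0Pn[a0 a0A] : A != fset0 by rewrite -cardfs_gt0.
have P0 : (0 < #|` prod_set (2 ^ K) P|)%N.
  apply: prod_set_gt0; rewrite cardfs_gt0; apply/fset0Pn.
  exists (a0 - a0 - r%:R * (a0 - a0) + 0%:R * (a0 - a0)).
  exact: sum_diff_set_shift.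
(* For small [A] the left side is at most 1, so nonemptiness suffices. *)
have [N3|N3] := ltnP N (3 * r.+1).
  apply: (@le_trans _ _ 1); last by rewrite ler1n.
  rewrite exprn_ile1// ler_pdivrMr ?ltr0n// mul1r.
  by rewrite ler_nat; lia.
(* Since [n >= 1], rounding down loses at most a factor 2, whence the 6 in the constant. The 3
   leaves room for [K * n] points and an offset of [r + 1]. *)
set n := (N %/ (3 * r.+1))%N.
have n0 : (0 < n)%N by rewrite divn_gt0.
have nN : (3 * r.+1 * n <= N)%N by rewrite mulnC leq_trunc_div.
have Nn : (N <= 6 * r.+1 * n)%N.
  by have := ltn_ceil N (isT : 0 < 3 * r.+1)%N; rewrite -/n; nia.
have KnN : (K * n + r.+1 <= N)%N by rewrite /K; nia.
suff nP : (n ^ r.+1 <= #|` prod_set (2 ^ K) P|)%N.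
  apply: (@le_trans _ _ (n ^ r.+1)%:R); last by rewrite ler_nat.
  rewrite natrX lerXn2r ?nnegrE//.
  by rewrite ler_pdivrMr ?ltr0n// -natrM ler_nat mulnC.
rewrite -leq_sqr -expnM; have -> : (r.+1 * 2 = K.+1)%N by rewrite /K; lia.
have [b [b' [bA b'A bb' gapP]]] : exists b b' : R, [/\ b \in A, b' \in A,
    b' < b & forall c c', c \in A -> c' \in A -> c' < c -> c' + (b - b') <= c].
  by apply: exists_min_gap; rewrite -/N; lia.
set h := b - b' in gapP; have h0 : 0 < h by rewrite subr_gt0.
pose a i := nth 0 (sort <=%R A) i.
have size_a : size (sort <=%R A) = N by rewrite size_sort.
have aA i : (i < N)%N -> a i \in A.
  by move=> iN; rewrite -(mem_sort <=%R) mem_nth// size_a.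
have aS i : (i.+1 < N)%N -> a i + h <= a i.+1.
  move=> iN; apply: gapP; [exact: aA|exact/aA/ltnW|].
  rewrite (lt_sorted_ltn_nth 0)// ?inE ?size_a ?(ltnW iN)//.
  by rewrite sort_lt_sorted fset_uniq.
have alb i : (i < N)%N -> a 0 + i%:R * h <= a i.
  elim: i => [|i IHi] iN; first by rewrite mul0r addr0.
  apply: le_trans (aS i iN); rewrite -natr1 mulrDl mul1r addrA lerD2r.
  exact/IHi/ltnW.
(* The offset [r + 1] gives [a (i + r + 1) - a 0 >= (i + r + 1) h], so [y i >= (i + 1) h] remains
   positive after subtracting [r h]. *)
pose y i := a (i + r.+1)%N - a 0 - r%:R * h.
apply: (@card_prod_set_separated _ _ h _ _ y) => // [i iK|i j iK jK].
  rewrite /y addSn; have := aS (i + r.+1)%N; set u := a _; set v := a _.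
  have iN : (((i + r.+1).+1) < N)%N by lia.
  by move=> /(_ iN); lra.
have iN : (i + r.+1 < N)%N by lia.
split; first by apply: sum_diff_set_shift => //; exact: aA.
have := alb _ iN; rewrite /y natrD -(natr1 r) => ai.
have := mulr_ge0 (ler0n R i) (ltW h0); have := mulr_ge0 (ler0n R j) (ltW h0).
by move: ai; rewrite !mulrDl mul1r; lra.
Qed.
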